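(* Let $p$ be a prime, let $m$ be an integer with $2 \le m \le p-1$, let $b \in \mathbb{F}_{p^2}$ satisfy $b^{p+1}=1$ (equivalently $b=r^{p-1}$ for some $r\in\mathbb{F}_{p^2}^*$), and let $\alpha,\beta\in\mathbb{F}_{p^2}^*$ satisfy $\alpha^{p+1}\neq\beta^{p+1}$ and $$(\beta+b\alpha)^{p-1}=(-1)^m b^{mp-1}.$$ Define $$\gamma=\frac{-\alpha}{\beta^{p+1}-\alpha^{p+1}},\quad \epsilon=\frac{\beta^p}{\beta^{p+1}-\alpha^{p+1}},\quad d=(-1)^m b^{mp},\quad \delta=\frac{-\gamma d-\epsilon}{(\beta^p-\alpha d)^m}.$$ Then the polynomial $$f(x)=(x^p-bx)^m+\alpha x^p+\beta x\in\mathbb{F}_{p^2}[x]$$ is a permutation polynomial of $\mathbb{F}_{p^2}$, and its compositional inverse is $$h(x)=\delta(x^p-dx)^m+\gamma x^p+\epsilon x,$$ i.e. $h(f(c))=c$ and $f(h(c))=c$ for all $c\in\mathbb{F}_{p^2}$.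
   Context: A permutation polynomial of a finite field $\mathbb{F}_q$ is a polynomial $f\in\mathbb{F}_q[x]$ whose evaluation map $\mathbb{F}_q\to\mathbb{F}_q$ is a bijection; its compositional inverse is a polynomial inducing the inverse map (polynomials are considered modulo $x^q-x$, i.e. as functions on $\mathbb{F}_q$). *)

(* Defs.v *)
From HB Require Import structures.
From mathcomp Require Import all_boot all_order all_algebra all_field.

Set Implicit Arguments.
Unset Strict Implicit.
Unset Printing Implicit Defensive.

Import GRing.Theory.
Local Open Scope ring_scope.

Definition permutation_poly (F : finFieldType) (f : {poly F}) : Prop :=
  bijective (fun c : F => f.[c]).

(* Only the induced functions on F matter, i.e. polynomials are taken modulo
   'X^#|F| - 'X, so the inverse is compared pointwise and not through \Po. *)
Definition compositional_inverse (F : finFieldType) (f h : {poly F}) : Prop :=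
  (forall c : F, h.[f.[c]] = c) /\ (forall c : F, f.[h.[c]] = c).

(* Main.v *)
(* Put u = x^p - b x and w = u^m. As b has norm 1, u^p = - b^p u, so w^p = d w,
   whence y = w + alpha x^p + beta x gives y^p - d y = A u with
   A = beta^p - alpha d: this is where the hypothesis on beta + b alpha enters.
   Thus (y^p - d y)^m recovers w up to the constant A^m, and what remains is to
   invert the linearized polynomial alpha x^p + beta x. *)

Require Import Defs.
From HB Require Import structures.
From mathcomp Require Import all_boot all_order all_algebra all_field.
From mathcomp Require Import ring.

Set Implicit Arguments.
Unset Strict Implicit.
Unset Printing Implicit Defensive.

Import GRing.Theory.
Local Open Scope ring_scope.

Section QuadraticExtension.

Variables (p : nat) (F : finFieldType).
Hypotheses (p_prime : prime p) (cardF : #|F| = (p ^ 2)%N).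

Lemma pchar_card_sqr : p \in [pchar F].
Proof. exact: card_finPcharP cardF p_prime. Qed.

Lemma frobeniusK (x : F) : (x ^+ p) ^+ p = x.
Proof. by rewrite -exprM mulnn -cardF expf_card. Qed.

Lemma frobeniusD (x y : F) : (x + y) ^+ p = x ^+ p + y ^+ p.
Proof. by rewrite exprDn_pchar // pnatE // pchar_card_sqr. Qed.

Lemma frobeniusN (x : F) : (- x) ^+ p = - x ^+ p.
Proof. by rewrite exprNn_pchar // pnatE // pchar_card_sqr. Qed.

(** Frobenius swaps [x] and [x ^+ p], giving [x - b ^+ p * x ^+ p]; pulling out [- b ^+ p] leaves
    [x] with coefficient [- b], the inverse of [b ^+ p] being [b]. *)
Lemma frobenius_twist (b x : F) : b ^+ p * b = 1 ->
  (x ^+ p - b * x) ^+ p = - b ^+ p * (x ^+ p - b * x).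
Proof.
move=> bN; rewrite frobeniusD frobeniusN exprMn frobeniusK.
by rewrite mulrBr mulrA !mulNr bN; ring.
Qed.

Lemma frobenius_twistX (b x : F) (m : nat) : b ^+ p * b = 1 ->
  ((x ^+ p - b * x) ^+ m) ^+ p
    = (-1) ^+ m * b ^+ (m * p) * (x ^+ p - b * x) ^+ m.
Proof.
move=> bN; rewrite exprAC frobenius_twist // exprMn (exprNn (b ^+ p)).
by rewrite -exprM (mulnC p).
Qed.

End QuadraticExtension.

Theorem theorem3 (p : nat) (F : finFieldType) (m : nat) (b alpha beta : F)
  (p_prime : prime p)
  (cardF : #|F| = (p ^ 2)%N)
  (m_bounds : (2 <= m <= p - 1)%N)
  (b_norm : b ^+ (p + 1) = 1)
  (alpha_neq0 : alpha <> 0)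
  (beta_neq0 : beta <> 0)
  (norm_neq : alpha ^+ (p + 1) <> beta ^+ (p + 1))
  (cond : (beta + b * alpha) ^+ (p - 1) = (-1) ^+ m * b ^+ (m * p - 1)) :
  let gamma : F := - alpha / (beta ^+ (p + 1) - alpha ^+ (p + 1)) in
  let epsilon : F := beta ^+ p / (beta ^+ (p + 1) - alpha ^+ (p + 1)) in
  let d : F := (-1) ^+ m * b ^+ (m * p) in
  let delta : F := (- gamma * d - epsilon) / (beta ^+ p - alpha * d) ^+ m in
  let f : {poly F} := ('X^p - b *: 'X) ^+ m + alpha *: 'X^p + beta *: 'X in
  let h : {poly F} :=
    delta *: ('X^p - d *: 'X) ^+ m + gamma *: 'X^p + epsilon *: 'X in
  permutation_poly f /\ compositional_inverse f h.
Proof.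
move=> gamma epsilon d delta f h.
have p_gt0 := prime_gt0 p_prime.
have bN : b ^+ p * b = 1 by rewrite -exprSr -addn1.
(* Guards the truncated exponent [m * p - 1]: one more factor [b] then turns the right side of
   [cond] into [d]. *)
have mp_gt0 : (0 < m * p)%N.
  by rewrite muln_gt0 p_gt0 andbT; case/andP: m_bounds => /ltnW.
(* Multiplying [cond] by [b * (beta + b * alpha)] and expanding by Frobenius makes it linear in the
   conjugates of [alpha] and [beta]. *)
have condE : alpha ^+ p - beta * d = - b * (beta ^+ p - alpha * d).
  have dE : d = (beta + b * alpha) ^+ (p - 1) * b.
    by rewrite cond -mulrA -exprSr subn1 prednK.
  have : (beta + b * alpha) ^+ p * b = d * (beta + b * alpha).
    by rewrite dE mulrAC -exprSr subn1 prednK.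
  rewrite (frobeniusD p_prime cardF) exprMn mulrDl mulrAC bN mul1r => E.
  have -> : alpha ^+ p = d * (beta + b * alpha) - beta ^+ p * b.
    by rewrite -E; ring.
  by ring.
set N := beta ^+ (p + 1) - alpha ^+ (p + 1) in gamma epsilon delta h *.
have NE : N = beta ^+ p * beta - alpha ^+ p * alpha by rewrite /N addn1 !exprSr.
have N_neq0 : N != 0 by rewrite subr_eq0 eq_sym; apply/eqP.
set A := beta ^+ p - alpha * d in condE delta h *.
(* If [A = 0], both [beta ^+ p = alpha * d] and, by [condE], [alpha ^+ p = beta * d], so the two
   norms equal [alpha * beta * d]. *)
have A_neq0 : A != 0.
  apply: contra_neq N_neq0 => A0.
  have aE : alpha ^+ p = beta * d.
    by apply/eqP; rewrite -subr_eq0 condE A0 mulr0.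
  have bE : beta ^+ p = alpha * d by apply/eqP; rewrite -subr_eq0 -/A A0.
  by rewrite NE aE bE; ring.
have fK c : h.[f.[c]] = c.
  set y := f.[c]; rewrite /h !(hornerE, horner_exp) /=.
  set u := c ^+ p - b * c.
  have yE : y = u ^+ m + alpha * c ^+ p + beta * c.
    by rewrite /y /f !(hornerE, horner_exp).
  have ypE : y ^+ p = d * u ^+ m + alpha ^+ p * c + beta ^+ p * c ^+ p.
    rewrite yE !(frobeniusD p_prime cardF) (frobenius_twistX p_prime cardF) //.
    by rewrite !exprMn (frobeniusK cardF).
  have -> : y ^+ p - d * y = A * u.
    have -> : y ^+ p - d * y = (alpha ^+ p - beta * d) * c + A * c ^+ p.
      by rewrite ypE yE /A; ring.
    by rewrite condE /u; ring.
  (* The denominator of [delta] cancels [A ^+ m], and its numerator is chosen to kill the [u ^+ m]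
     terms of [gamma * y ^+ p + epsilon * y]. In what is left, [c ^+ p] has coefficient 0 and [c]
     has coefficient [N / N]. *)
  rewrite exprMn mulrA /delta divfK ?expf_neq0 // ypE yE.
  rewrite /gamma /epsilon; move: NE N_neq0 => -> N_neq0.
  by field.
(* As [F] is finite, the left inverse [h] already makes [f] bijective and is then two-sided. *)
have f_inj : injective (fun c : F => f.[c]) by apply: can_inj fK.
have f_bij := injF_bij f_inj.
split=> //; split=> // c.
by have [g _ gK] := f_bij; rewrite -[c]gK fK.
Qed.
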